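(* Consider the Payne-Whitham (PW) traffic model in Lagrangian variables with functions $U,p$ satisfying the assumptions stated in the context. Let $v_S\in I$, put $m_S=\sqrt{-p'(v_S)}$, and suppose that the non-degeneracy condition $U'(v_S)\neq m_S$ holds. Then there exists a jamiton with sonic value $v_S$ if and only if the base state solution $v\equiv v_S$, $u\equiv U(v_S)$ of the PW model is (linearly) unstable.
   Context: Setting. $I=(v_{\min},\infty)$ with $v_{\min}\ge 0$ is the interval of admissible specific volumes $v=1/\rho$ ($\rho$ is the vehicle density; typically $v_{\min}=1/\rho_{\max}$). The relaxation time is $\tau>0$. The desired velocity $U:I\to\mathbb{R}$ and the traffic pressure $p:I\to\mathbb{R}$ are twice continuously differentiable functions of $v$ with $U'(v)>0$, $U''(v)<0$, $p'(v)<0$, $p''(v)>0$ for all $v\in I$ (primes denote $d/dv$). PW model in Lagrangian variables ($\sigma$ = vehicle number, $u$ = velocity): $$v_t-u_\sigma=0,\qquad u_t+(p(v))_\sigma=\tfrac1\tau\,(U(v)-u).$$ Linear stability. The base state $(v,u)\equiv(v_S,U(v_S))$ is linearly stable if infinitesimal perturbations decay in time, i.e. if every nontrivial solution of the form $(V,W)e^{ik\sigma+\lambda t}$, with $k\in\mathbb{R}\setminus\{0\}$ and $(V,W)\in\mathbb{C}^2\setminus\{0\}$, of the system linearized about the base state satisfies $\operatorname{Re}\lambda<0$. It is unstable if it is not linearly stable. The non-degeneracy condition $U'(v_S)\ne m_S$ expresses that the characteristic velocity $\mu=Q'(\rho)$, with $Q(\rho)=\rho\,U$, of the reduced first order model $\rho_t+(Q(\rho))_x=0$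 does not coincide with one of the two (Eulerian) characteristic velocities of the PW model at the base state. Jamiton. A jamiton with sonic value $v_S$ is a traveling wave in the self-similar variable $\chi=(mt+\sigma)/\tau$, where $m>0$ is the number with $p'(v_S)=-m^2$, that consists of a smooth part of finite length with an attached shock traveling at the same speed. Precisely, it is a pair of $C^1$ functions $(v(\chi),u(\chi))$ on a compact interval $[\chi^+,\chi^-]$, $\chi^+<\chi^-$, with $v$ taking values in $I$, such that: (1) $m v'(\chi)-u'(\chi)=0$ and $m u'(\chi)+p'(v(\chi))v'(\chi)=U(v(\chi))-u(\chi)$ on $[\chi^+,\chi^-]$; (2) writing $(v^\pm,u^\pm)=(v(\chi^\pm),u(\chi^\pm))$, the shock with left state $(v^-,u^-)$ and right state $(v^+,u^+)$ satisfies the Rankine-Hugoniot conditions $m[v]-[u]=0$, $m[u]+[p(v)]=0$, where $[z]$ is the jump of $z$ across the shock; (3) the shock satisfies the Lax entropy condition, which here reads $v^->v^+$. (Repeating such a profile periodically gives an infinite periodic chain of jamitons connected by shocks.) *)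

(* Defs.v *)
From Stdlib Require Import Reals.
From Coquelicot Require Import Coquelicot.
Open Scope R_scope.

(* The PW model is
     v_t - u_sigma = 0,   u_t + (p(v))_sigma = (U(v) - u) / tau,
   with v ranging over I = (vmin, +oo).  U and p are total functions R -> R, but
   only their values on the open set I are ever constrained or used. *)

(* [ex_derive f v] is not redundant: [Derive f] is total, so differentiability of
   [Derive f] alone says nothing about differentiability of f. *)
Definition C2_on_I (vmin : R) (f : R -> R) : Prop :=
  forall v, vmin < v ->
    ex_derive f v /\ ex_derive (Derive f) v /\ continuous (Derive (Derive f)) v.

(* f is C^1 on the compact interval [a, b] with derivative df.  [D_in] and
   [continue_in] are relative to [a, b], hence one-sided at the end points. *)
Definition C1_on (a b : R) (f df : R -> R) : Prop :=
  forall x, a <= x <= b ->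
    D_in f df (fun y => a <= y <= b) x /\ continue_in df (fun y => a <= y <= b) x.

Definition jump (zl zr : R) : R := zr - zl.

(* The profile (v, u), with derivatives dv and du on [chip, chim], is a function of
   chi = (m t + sigma) / tau; tau drops out of the profile equations.  The state
   left of the shock is the one at chim, the state right of it the one at chip. *)
Record jamiton (U p : R -> R) (vmin vS m chip chim : R) (v u dv du : R -> R)
    : Prop := {
  jam_speed_pos : 0 < m;
  jam_sonic : Derive p vS = - m ^ 2;
  jam_interval : chip < chim;
  jam_v_C1 : C1_on chip chim v dv;
  jam_u_C1 : C1_on chip chim u du;
  jam_range : forall chi, chip <= chi <= chim -> vmin < v chi;
  jam_mass : forall chi, chip <= chi <= chim -> m * dv chi - du chi = 0;
  jam_momentum : forall chi, chip <= chi <= chim ->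
    m * du chi + Derive p (v chi) * dv chi = U (v chi) - u chi;
  jam_RH_mass : m * jump (v chim) (v chip) - jump (u chim) (u chip) = 0;
  jam_RH_momentum :
    m * jump (u chim) (u chip) + jump (p (v chim)) (p (v chip)) = 0;
  jam_Lax : v chip < v chim
}.

Definition exists_jamiton (U p : R -> R) (vmin vS : R) : Prop :=
  exists (m chip chim : R) (v u dv du : R -> R),
    jamiton U p vmin vS m chip chim v u dv du.

Definition Cexp (z : C) : C := (exp (Re z) * cos (Im z), exp (Re z) * sin (Im z)).

(* Derivative of a complex-valued function of a real variable. *)
Definition is_deriveRC (f : R -> C) (x : R) (l : C) : Prop :=
  @is_derive R_AbsRing C_R_NormedModule f x l.

(* Linearization of the PW model about (v, u) = (vS, U(vS)): substituting
   v = vS + eps * y, u = U(vS) + eps * w and keeping the terms of order eps gives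
     y_t - w_sigma = 0,
     w_t + p'(vS) y_sigma = (U'(vS) y - w) / tau.
   The perturbation (y, w) is complex valued; its arguments are sigma, then t. *)
Definition solves_linearized_PW (U p : R -> R) (tau vS : R) (y w : R -> R -> C)
    : Prop :=
  forall sigma t : R, exists y_s y_t w_s w_t : C,
    is_deriveRC (fun s => y s t) sigma y_s /\
    is_deriveRC (fun r => y sigma r) t y_t /\
    is_deriveRC (fun s => w s t) sigma w_s /\
    is_deriveRC (fun r => w sigma r) t w_t /\
    (y_t - w_s = RtoC 0)%C /\
    (w_t + RtoC (Derive p vS) * y_s
       = RtoC (1 / tau) * (RtoC (Derive U vS) * y sigma t - w sigma t))%C.

Definition normal_mode (A : C) (k : R) (lambda : C) : R -> R -> C :=
  fun sigma t => (A * Cexp (Ci * RtoC k * RtoC sigma + lambda * RtoC t))%C.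

Definition linearly_stable (U p : R -> R) (tau vS : R) : Prop :=
  forall (k : R) (V W lambda : C),
    k <> 0 ->
    ~ (V = RtoC 0 /\ W = RtoC 0) ->
    solves_linearized_PW U p tau vS (normal_mode V k lambda) (normal_mode W k lambda) ->
    Re lambda < 0.

Definition linearly_unstable (U p : R -> R) (tau vS : R) : Prop :=
  ~ linearly_stable U p tau vS.

(* Main.v *)
Require Import Defs.
From Stdlib Require Import Reals Lra Psatz.
From Coquelicot Require Import Coquelicot.
Open Scope R_scope.

(** Put [m = sqrt (- p' vS)].  The dispersion relation of the linearized system has
    a root with nonnegative real part, for some wave number, if [U' vS > m], and
    none if [U' vS < m].  On a jamiton [u - m v] is constant and the shock joins two
    points on the same level of the convex function [p v + m^2 v], so [v] passes
    through [vS] and solves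
    [(p' v + m^2) v' = U v - U vS - m (v - vS)].
    If [U' vS < m], concavity of [U] makes [v' < 0] wherever [v > vS], so [v] cannot
    rise from [v+ < vS] to [v- > vS].  If [U' vS > m], the common zero at [vS] cancels
    and the equation becomes [v' = F v] with [F] continuous and positive near [vS],
    which is solved by quadrature. *)

(** * Normal modes, the dispersion relation and linear stability *)

Lemma is_deriveRC_pair (f g : R -> R) (x a b : R) :
  is_derive f x a -> is_derive g x b ->
  is_deriveRC (fun t => (f t, g t)) x (a, b).
Proof.
  intros Hf Hg.
  apply (filterdiff_ext_lin _ (fun y : R => (scal y a, scal y b))).
  - apply (filterdiff_comp_2 f g (fun u v => (u, v)) (fun y => scal y a)
      (fun y => scal y b) (fun u v => (u, v))); [exact Hf | exact Hg |].
    apply (filterdiff_ext_lin _ (fun u => u)).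
    + apply (filterdiff_ext (fun u => u)); [now intros [u v] |].
      apply filterdiff_id.
    + now intros [u v].
  - reflexivity.
Qed.

(** [solves_linearized_PW] only asserts that some derivatives exist; uniqueness, checked
    coordinatewise, identifies them with the explicit ones. *)
Lemma is_deriveRC_unique (f : R -> C) (x : R) (a b : C) :
  is_deriveRC f x a -> is_deriveRC f x b -> a = b.
Proof.
  assert (H : forall l, is_deriveRC f x l ->
    is_derive (fun t => fst (f t)) x (fst l) /\
    is_derive (fun t => snd (f t)) x (snd l)).
  { intros l Hl; split.
    - apply (filterdiff_comp f fst (fun y => scal y l) fst Hl).
      apply filterdiff_linear, is_linear_fst.
    - apply (filterdiff_comp f snd (fun y => scal y l) snd Hl).
      apply filterdiff_linear, is_linear_snd. }
  intros Ha Hb.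
  destruct (H a Ha) as [Ha1 Ha2], (H b Hb) as [Hb1 Hb2].
  apply is_derive_unique in Ha1, Ha2, Hb1, Hb2.
  apply injective_projections; congruence.
Qed.

Lemma is_deriveRC_Cexp (A z c : C) (x : R) :
  is_deriveRC (fun t => A * Cexp (z + c * RtoC t))%C x
    (A * c * Cexp (z + c * RtoC x))%C.
Proof.
  destruct A as [A1 A2], z as [z1 z2], c as [c1 c2].
  unfold Cexp, Cmult, Cplus, RtoC, Re, Im; cbn [fst snd].
  apply is_deriveRC_pair; auto_derive; trivial; unfold Rminus; ring.
Qed.

Lemma Cexp_0 : Cexp (RtoC 0) = RtoC 1.
Proof.
  unfold Cexp, Re, Im, RtoC; cbn [fst snd].
  now rewrite exp_0, cos_0, sin_0, Rmult_1_r, Rmult_0_r.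
Qed.

(** Differentiation multiplies a mode by [Ci * k] or [lambda], so the exponential factors out of
    both equations. In the forward direction it is removed by evaluating at the origin, where it
    equals 1. *)
Lemma normal_mode_solves (U p : R -> R) (tau vS k : R) (V W lambda : C) :
  solves_linearized_PW U p tau vS (normal_mode V k lambda) (normal_mode W k lambda)
  <->
  (lambda * V = Ci * RtoC k * W /\
   lambda * W + RtoC (Derive p vS) * (Ci * RtoC k * V)
     = RtoC (1 / tau) * (RtoC (Derive U vS) * V - W))%C.
Proof.
  set (E s t := Cexp (Ci * RtoC k * RtoC s + lambda * RtoC t)%C).
  assert (Ds : forall A s t,
    is_deriveRC (fun s => normal_mode A k lambda s t) s
      (A * (Ci * RtoC k) * E s t)%C).
  { intros A s t; unfold E; rewrite Cplus_comm.
    apply (is_derive_ext (fun s => A * Cexp (lambda * RtoC t + Ci * RtoC k * RtoC s))%C);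
      [| apply is_deriveRC_Cexp].
    intros s'; unfold normal_mode; now rewrite Cplus_comm. }
  assert (Dt : forall A s t,
    is_deriveRC (fun t => normal_mode A k lambda s t) t (A * lambda * E s t)%C)
    by (intros; apply is_deriveRC_Cexp).
  split.
  - intros H; destruct (H 0 0) as (ys & yt & ws & wt & Hys & Hyt & Hws & Hwt & E1 & E2).
    rewrite (is_deriveRC_unique _ _ _ _ Hys (Ds V 0 0)) in E2.
    rewrite (is_deriveRC_unique _ _ _ _ Hyt (Dt V 0 0)) in E1.
    rewrite (is_deriveRC_unique _ _ _ _ Hws (Ds W 0 0)) in E1.
    rewrite (is_deriveRC_unique _ _ _ _ Hwt (Dt W 0 0)) in E2.
    unfold normal_mode in E2; fold (E 0 0) in E2.
    replace (E 0 0) with (RtoC 1) in *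
      by (unfold E; rewrite <- Cexp_0; f_equal; ring).
    split.
    + transitivity (V * lambda * 1 - W * (Ci * k) * 1 + Ci * k * W)%C; [ring |].
      rewrite E1; ring.
    + transitivity (W * lambda * 1 + Derive p vS * (V * (Ci * k) * 1))%C; [ring |].
      rewrite E2; ring.
  - intros [E1 E2] s t.
    exists (V * (Ci * k) * E s t)%C, (V * lambda * E s t)%C,
      (W * (Ci * k) * E s t)%C, (W * lambda * E s t)%C.
    split; [apply Ds |]; split; [apply Dt |].
    split; [apply Ds |]; split; [apply Dt |]; split.
    + transitivity ((lambda * V - Ci * k * W) * E s t)%C; [ring |].
      rewrite E1; ring.
    + unfold normal_mode; fold (E s t).
      transitivity ((lambda * W + Derive p vS * (Ci * k * V)) * E s t)%C; [ring |].
      rewrite E2; ring.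
Qed.

(* Eliminating [W] gives the dispersion relation
   [lambda^2 + lambda / tau - p' k^2 - i k U' / tau = 0], split here into its real
   and imaginary parts. *)
Lemma normal_mode_dispersion (U p : R -> R) (tau vS k a b : R) :
  0 < tau -> k <> 0 ->
  (exists V W : C, ~ (V = RtoC 0 /\ W = RtoC 0) /\
    solves_linearized_PW U p tau vS (normal_mode V k (a, b)) (normal_mode W k (a, b)))
  <->
  a ^ 2 - b ^ 2 + a / tau - Derive p vS * k ^ 2 = 0 /\
  2 * a * b + b / tau = k * Derive U vS / tau.
Proof.
  intros Htau Hk.
  set (P := Derive p vS); set (D := Derive U vS).
  assert (Htau' : tau <> 0) by lra.
  split.
  - intros (V & W & Hne & H).
    apply normal_mode_solves in H; fold P D in H; destruct H as [E1 E2].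
    (* [Z] is the dispersion polynomial at [lambda = (a, b)]. It annihilates [V]: multiply the
       second equation by [Ci * k] and eliminate [W] with the first. Since [V = 0] would force
       [W = 0], it follows that [Z = 0]. *)
    set (Z := ((a, b) * (a, b) + RtoC (1 / tau) * (a, b) - RtoC P * RtoC k * RtoC k
               - RtoC (1 / tau) * (Ci * RtoC k * RtoC D))%C).
    assert (HZ : (Z * V = 0)%C).
    { assert (Ci2 : (Ci * Ci = - RtoC 1)%C)
        by (apply injective_projections; simpl; ring).
      unfold Z.
      transitivity ((a, b) * ((a, b) * V) + RtoC (1 / tau) * ((a, b) * V)
        + (Ci * Ci) * RtoC P * RtoC k * RtoC k * V
        - RtoC (1 / tau) * (Ci * RtoC k * RtoC D) * V)%C; [rewrite Ci2; ring |].
      rewrite E1.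
      transitivity (Ci * RtoC k * ((a, b) * W + P * (Ci * k * V) -
        RtoC (1 / tau) * (D * V - W)))%C; [ring |].
      rewrite E2; ring. }
    destruct (Ceq_dec V 0) as [HV | HV].
    + exfalso; apply Hne; split; [exact HV |].
      rewrite HV, Cmult_0_r in E1.
      destruct (Ceq_dec W 0) as [HW | HW]; [exact HW | exfalso].
      symmetry in E1; revert E1.
      apply Cmult_neq_0; [| exact HW].
      intros Hik; apply (f_equal snd) in Hik; simpl in Hik; lra.
    + destruct (Ceq_dec Z 0) as [HZ0 | HZ0];
        [| now elim (Cmult_neq_0 _ _ HZ0 HV)].
      unfold Z in HZ0.
      pose proof (f_equal fst HZ0) as H1; pose proof (f_equal snd HZ0) as H2.
      simpl in H1, H2; unfold Rdiv in *; split; nra.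
  - intros [H1 H2].
    (* For this choice the first equation is an identity and the second is the dispersion
       relation. *)
    exists (Ci * RtoC k)%C, (a, b).
    split.
    + intros [Hik _]; apply (f_equal snd) in Hik; simpl in Hik; lra.
    + apply normal_mode_solves; fold P D; split; [ring |].
      apply injective_projections; simpl; unfold Rdiv in *; nra.
Qed.

(** Write [D], [P] for the derivatives of [U], [p] at [vS] and suppose [a >= 0]. The imaginary part,
    [b (1 + 2 a tau) = k D], gives [b^2 <= k^2 D^2], and the real part becomes [a^2 + a / tau = b^2
    + P k^2 <= k^2 (D^2 + P) < 0], a contradiction. *)
Lemma stable_of_lt (U p : R -> R) (tau vS : R) :
  0 < tau -> 0 < Derive U vS -> Derive U vS ^ 2 < - Derive p vS ->
  linearly_stable U p tau vS.
Proof.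
  intros Htau HU Hlt k V W [a b] Hk Hne H; simpl.
  destruct (proj1 (normal_mode_dispersion U p tau vS k a b Htau Hk)) as [E1 E2];
    [now exists V, W |].
  destruct (Rlt_le_dec a 0) as [Ha | Ha]; [exact Ha | exfalso].
  revert HU Hlt E1 E2; generalize (Derive U vS) (Derive p vS); intros D P HU Hlt E1 E2.
  assert (Hb : b * (1 + 2 * a * tau) = k * D).
  { replace (k * D) with (tau * (k * D / tau)) by (field; lra).
    rewrite <- E2; field; lra. }
  assert (Hq : 1 <= 1 + 2 * a * tau) by nra.
  assert (Hb2 : b ^ 2 <= (k * D) ^ 2).
  { rewrite <- Hb, Rpow_mult_distr.
    assert (1 <= (1 + 2 * a * tau) ^ 2) by nra.
    assert (0 <= b ^ 2) by nra. nra. }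
  assert (0 <= a / tau) by (apply Rdiv_le_0_compat; lra).
  assert (0 < k ^ 2) by nra.
  assert (k ^ 2 * D ^ 2 < k ^ 2 * - P) by (apply Rmult_lt_compat_l; lra).
  nra.
Qed.

Lemma unstable_of_gt (U p : R -> R) (tau vS m : R) :
  0 < tau -> 0 < m -> Derive p vS = - m ^ 2 -> m < Derive U vS ->
  linearly_unstable U p tau vS.
Proof.
  intros Htau Hm Hp HU Hst.
  set (D := Derive U vS) in *.
  (* With [1 + 2 a tau = q] the relation forces [b = k D / q], and then [k] is
     determined by [k^2 (D^2 / q^2 - m^2) = a^2 + a / tau]; this is solvable as
     soon as [1 < q < D / m]. *)
  set (q := (D + m) / (2 * m)).
  assert (Hq1 : 1 < q) by (apply Rlt_div_r; lra).
  assert (Hq2 : q * m < D) by (unfold q; replace ((D + m) / (2 * m) * m)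
    with ((D + m) / 2) by (field; lra); lra).
  set (a := (q - 1) / (2 * tau)).
  assert (Ha : 0 < a) by (apply Rdiv_lt_0_compat; lra).
  set (den := (D / q) ^ 2 - m ^ 2).
  assert (Hden : 0 < den).
  { assert (m < D / q) by (apply Rlt_div_r; lra). unfold den; nra. }
  assert (Hnum : 0 < a ^ 2 + a / tau).
  { assert (0 < a / tau) by (apply Rdiv_lt_0_compat; lra). nra. }
  set (k := sqrt ((a ^ 2 + a / tau) / den)).
  assert (Hk : 0 < k) by (apply sqrt_lt_R0, Rdiv_lt_0_compat; lra).
  assert (Hk2 : k ^ 2 * den = a ^ 2 + a / tau).
  { unfold k; rewrite pow2_sqrt by (apply Rlt_le, Rdiv_lt_0_compat; lra).
    field; lra. }
  destruct (proj2 (normal_mode_dispersion U p tau vS k a (k * D / q) Htau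
    (Rgt_not_eq _ _ Hk))) as (V & W & Hne & Hsol).
  - fold D; rewrite Hp; split.
    + unfold den in Hk2.
      replace ((k * D / q) ^ 2) with (k ^ 2 * (D / q) ^ 2) by (field; lra).
      nra.
    + unfold a; field; lra.
  - pose proof (Hst k V W (a, k * D / q) (Rgt_not_eq _ _ Hk) Hne Hsol) as H.
    simpl in H; lra.
Qed.

(** * Calculus on a compact interval *)

Lemma Derive_mvt (f : R -> R) (a b : R) :
  a < b -> (forall x, a <= x <= b -> ex_derive f x) ->
  exists c, a < c < b /\ f b - f a = Derive f c * (b - a).
Proof.
  intros Hab Hf.
  destruct (MVT_cor2 f (Derive f) a b Hab) as (c & Hc & Hcab).
  - intros c Hc; apply is_derive_Reals, Derive_correct, Hf, Hc.
  - now exists c.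
Qed.

(** Composition with [clamp a b] turns a function controlled only on [[a, b]] into one on the whole
    line, to which global continuity and the intermediate value theorem apply. *)
Definition clamp (a b x : R) : R := Rmax a (Rmin b x).

Lemma clamp_range (a b x : R) : a <= b -> a <= clamp a b x <= b.
Proof.
  intros Hab; unfold clamp.
  split; [apply Rmax_l | apply Rmax_lub; [exact Hab | apply Rmin_l]].
Qed.

Lemma clamp_id (a b x : R) : a <= x <= b -> clamp a b x = x.
Proof.
  intros Hx; unfold clamp.
  rewrite Rmin_right, Rmax_right; lra.
Qed.

Lemma clamp_lipschitz (a b x y : R) :
  Rabs (clamp a b x - clamp a b y) <= Rabs (x - y).
Proof.
  unfold clamp, Rmax, Rmin, Rabs.
  repeat (destruct (Rle_dec _ _) || destruct (Rcase_abs _)); lra.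
Qed.

Lemma continue_in_clamp (f : R -> R) (a b : R) :
  a <= b ->
  (forall x, a <= x <= b -> continue_in f (fun y => a <= y <= b) x) ->
  continuity (fun x => f (clamp a b x)).
Proof.
  intros Hab Hf x eps Heps.
  destruct (Hf (clamp a b x) (clamp_range a b x Hab) eps Heps) as (d & Hd & H).
  exists d; split; [exact Hd |].
  intros y [_ Hy].
  (* [continue_in] excludes the base point, so points with the same clamp are treated apart. *)
  destruct (Req_dec (clamp a b x) (clamp a b y)) as [E | E].
  - rewrite <- E; unfold dist; simpl; rewrite Rdist_eq; exact Heps.
  - apply H; split; [split; [apply clamp_range, Hab | exact E] |].
    eapply Rle_lt_trans; [apply clamp_lipschitz | exact Hy].
Qed.

Lemma continuous_clamp (f : R -> R) (a b : R) :
  a <= b -> (forall x, a <= x <= b -> continuous f x) ->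
  continuity (fun x => f (clamp a b x)).
Proof.
  intros Hab Hf; apply continue_in_clamp; [exact Hab |].
  intros x Hx eps Heps.
  destruct (proj2 (continuity_pt_filterlim f x) (Hf x Hx) eps Heps) as (d & Hd & H).
  exists d; split; [exact Hd |].
  intros y [[_ Hy] Hyd]; apply H; repeat split; assumption.
Qed.

Lemma C1_on_clamp_continuity (a b : R) (f df : R -> R) :
  a <= b -> C1_on a b f df -> continuity (fun x => f (clamp a b x)).
Proof.
  intros Hab Hf; apply continue_in_clamp; [exact Hab |].
  intros x Hx; apply (cont_deriv f df), Hf, Hx.
Qed.

Lemma C1_on_clamp_derive (a b : R) (f df : R -> R) (x : R) :
  C1_on a b f df -> a < x < b -> is_derive (fun y => f (clamp a b y)) x (df x).
Proof.
  intros Hf Hx; apply is_derive_Reals; intros eps Heps.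
  destruct (proj1 (Hf x ltac:(lra)) eps Heps) as (d & Hd & H).
  (* This radius keeps [x + h] inside [(a, b)], where the clamp is the identity. *)
  assert (Hd' : 0 < Rmin d (Rmin (x - a) (b - x))) by (repeat apply Rmin_glb_lt; lra).
  exists (mkposreal _ Hd'); simpl; intros h Hh Hhd.
  assert (Rabs h < d /\ Rabs h < x - a /\ Rabs h < b - x) as (H1 & H2 & H3).
  { repeat split; eapply Rlt_le_trans; try exact Hhd;
      [apply Rmin_l | eapply Rle_trans; [apply Rmin_r |] ..];
      [apply Rmin_l | apply Rmin_r]. }
  apply Rabs_lt_between in H2, H3.
  rewrite !clamp_id by lra.
  specialize (H (x + h)); unfold dist in H; simpl in H; unfold Rdist in H.
  replace (x + h - x) with h in H by ring.
  apply H; split; [split; lra | exact H1].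
Qed.

(** The mean value theorem for [phi] composed with [f]. It serves with [phi] the identity and its
    negative, to show that [u - m v] is constant, and with [phi] the square of a positive part. *)
Lemma C1_on_comp_nonincr (a b : R) (f df phi dphi : R -> R) :
  C1_on a b f df ->
  (forall s, is_derive phi s (dphi s)) ->
  (forall x, a <= x <= b -> dphi (f x) * df x <= 0) ->
  forall x y, a <= x -> x <= y -> y <= b -> phi (f y) <= phi (f x).
Proof.
  intros Hf Hphi Hneg x y Hax [Hxy | ->] Hyb; [| lra].
  destruct (MVT_gen (fun t => phi (f (clamp a b t))) x y
    (fun t => dphi (f t) * df t)) as (c & Hc & E);
    rewrite ?Rmin_left, ?Rmax_right in * by lra.
  - intros t Ht.
    pose proof (is_derive_comp phi (fun t => f (clamp a b t)) t _ _
      (Hphi _) (C1_on_clamp_derive a b f df t Hf ltac:(lra))) as D.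
    rewrite clamp_id in D by lra; unfold scal in D; simpl in D.
    unfold mult in D; simpl in D; rewrite Rmult_comm; exact D.
  - intros t _; apply (continuity_pt_comp (fun t => f (clamp a b t)) phi).
    + apply (C1_on_clamp_continuity a b f df); [lra | exact Hf].
    + apply derivable_continuous_pt; exists (dphi (f (clamp a b t))).
      apply is_derive_Reals, Hphi.
  - rewrite !clamp_id in E by lra.
    pose proof (Hneg c ltac:(lra)); nra.
Qed.

Lemma C1_on_of_derive (a b : R) (f df : R -> R) :
  (forall x, is_derive f x (df x)) -> (forall x, continuous df x) ->
  C1_on a b f df.
Proof.
  intros Hf Hdf x Hx; split.
  - apply (D_in_imp f df no_cond); [easy |].
    apply derivable_pt_lim_D_in, is_derive_Reals, Hf.
  - intros eps Heps.
    destruct (proj2 (continuity_pt_filterlim df x) (Hdf x) eps Heps) as (d & Hd & H).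
    exists d; split; [exact Hd |].
    intros y [[_ Hy] Hyd]; apply H; repeat split; assumption.
Qed.

(** Squaring removes the corner at [c]: the first-order remainder is at most [h^2] in every sign
    case, so [eps] itself serves as radius. *)
Lemma is_derive_pos_part_sqr (c s : R) :
  is_derive (fun s => Rmax 0 (s - c) ^ 2) s (2 * Rmax 0 (s - c)).
Proof.
  apply is_derive_Reals; intros eps Heps.
  exists (mkposreal eps Heps); simpl; intros h Hh Hheps.
  replace ((Rmax 0 (s + h - c) * (Rmax 0 (s + h - c) * 1) -
    Rmax 0 (s - c) * (Rmax 0 (s - c) * 1)) / h - 2 * Rmax 0 (s - c))
    with ((Rmax 0 (s + h - c) ^ 2 - Rmax 0 (s - c) ^ 2 - 2 * Rmax 0 (s - c) * h) / h)
    by (field; exact Hh).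
  rewrite Rabs_div by exact Hh.
  assert (0 < Rabs h) by now apply Rabs_pos_lt.
  apply Rlt_div_l; [assumption |].
  apply Rle_lt_trans with (Rabs h * Rabs h); [| now apply Rmult_lt_compat_r].
  rewrite <- Rabs_mult, (Rabs_pos_eq (h * h)) by nra.
  apply Rabs_le_between.
  unfold Rmax; destruct (Rle_dec 0 (s + h - c)), (Rle_dec 0 (s - c)); nra.
Qed.

(** * Difference quotients and autonomous equations *)

(* The Carathéodory quotient of [f] at [x0]. *)
Definition slope (f : R -> R) (x0 x : R) : R :=
  if Req_EM_T x x0 then Derive f x0 else (f x - f x0) / (x - x0).

Lemma slope_mul (f : R -> R) (x0 x : R) : slope f x0 x * (x - x0) = f x - f x0.
Proof.
  unfold slope; destruct (Req_EM_T x x0) as [-> | H]; [ring | field; lra].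
Qed.

Lemma slope_diag (f : R -> R) (x0 : R) : slope f x0 x0 = Derive f x0.
Proof. unfold slope; now destruct (Req_EM_T x0 x0). Qed.

(** By the mean value theorem, a slope off the diagonal is a derivative at an intermediate point. *)
Lemma slope_gt (f : R -> R) (a b x0 l : R) :
  (forall x, a <= x <= b -> ex_derive f x /\ l < Derive f x) ->
  a <= x0 <= b -> forall x, a <= x <= b -> l < slope f x0 x.
Proof.
  intros Hf Hx0 x Hx.
  destruct (Rtotal_order x x0) as [H | [-> | H]].
  - destruct (Derive_mvt f x x0 H) as (c & Hc & E); [intros; apply Hf; lra |].
    pose proof (slope_mul f x0 x).
    replace (slope f x0 x) with (Derive f c); [apply Hf; lra |].
    apply (Rmult_eq_reg_r (x - x0)); lra.
  - rewrite slope_diag; apply Hf, Hx.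
  - destruct (Derive_mvt f x0 x H) as (c & Hc & E); [intros; apply Hf; lra |].
    pose proof (slope_mul f x0 x).
    replace (slope f x0 x) with (Derive f c); [apply Hf; lra |].
    apply (Rmult_eq_reg_r (x - x0)); lra.
Qed.

(** At [x0] this is differentiability of [f]; elsewhere the slope is locally an ordinary
    quotient. *)
Lemma continuous_slope (f : R -> R) (x0 x : R) :
  ex_derive f x0 -> ex_derive f x -> continuous (slope f x0) x.
Proof.
  intros H0 Hx.
  destruct (Req_dec x x0) as [-> | Hne].
  - apply continuity_pt_filterlim; intros eps Heps.
    destruct (proj1 (is_derive_Reals f x0 _) (Derive_correct f x0 H0) eps Heps)
      as [d Hd].
    exists d; split; [apply cond_pos |].
    intros y [[_ Hy] Hyd]; unfold dist in *; simpl in *; unfold Rdist in *.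
    rewrite slope_diag; unfold slope.
    destruct (Req_EM_T y x0) as [E | _]; [now elim Hy |].
    specialize (Hd (y - x0)); replace (x0 + (y - x0)) with y in Hd by ring.
    apply Hd; [lra | exact Hyd].
  - apply continuous_ext_loc with (fun x => (f x - f x0) / (x - x0)).
    + assert (Hd : 0 < Rabs (x - x0)) by (apply Rabs_pos_lt; lra).
      exists (mkposreal _ Hd); intros y Hy; unfold slope.
      destruct (Req_EM_T y x0) as [-> | _]; [| reflexivity].
      exfalso; unfold ball in Hy; simpl in Hy; unfold AbsRing_ball, abs, minus, plus, opp in Hy;
        simpl in Hy.
      rewrite <- Rabs_Ropp in Hy.
      replace (- (x0 + - x)) with (x - x0) in Hy by ring; lra.
    + apply (ex_derive_continuous (fun x => (f x - f x0) / (x - x0))).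
      auto_derive; split; [exact Hx | lra].
Qed.

Lemma is_derive_of_quotient (f q : R -> R) (x0 : R) :
  continuous q x0 -> (forall x, f x - f x0 = q x * (x - x0)) ->
  is_derive f x0 (q x0).
Proof.
  intros Hq Hf; apply is_derive_Reals; intros eps Heps.
  destruct (proj2 (continuity_pt_filterlim q x0) Hq eps Heps) as (d & Hd & H).
  exists (mkposreal d Hd); intros h Hh Hhd.
  rewrite Hf; replace (x0 + h - x0) with h by ring.
  replace (q (x0 + h) * h / h) with (q (x0 + h)) by (field; exact Hh).
  apply H; split; [split; [exact I | lra] |].
  unfold dist; simpl; unfold Rdist; now replace (x0 + h - x0) with h by ring.
Qed.

(* The solution is the inverse of [G x = RInt (/ F) x0 x]. *)
Lemma autonomous_flow (F : R -> R) (M x0 : R) :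
  (forall x, continuous F x) -> (forall x, 0 < F x <= M) ->
  exists v : R -> R, v 0 = x0 /\ (forall t, is_derive v t (F (v t))) /\
    (forall x, exists t, v t = x).
Proof.
  intros HF HM.
  assert (HM0 : 0 < M) by (pose proof (HM 0); lra).
  assert (Hc : forall x, continuous (fun y => / F y) x).
  { intros x; apply continuity_pt_filterlim.
    apply (continuity_pt_inv F); [apply continuity_pt_filterlim, HF |].
    pose proof (HM x); lra. }
  set (G x := RInt (fun y => / F y) x0 x).
  assert (DG : forall x, is_derive G x (/ F x)).
  { intros x; apply (is_derive_RInt (fun y => / F y) G x0 x); [| apply Hc].
    apply filter_forall; intros y; apply (RInt_correct (fun y => / F y)).
    apply (ex_RInt_continuous (fun y => / F y)); intros; apply Hc. }
  assert (exDG : forall x, ex_derive G x) by (intros x; eexists; apply DG).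
  assert (HG : forall x y, / M <= slope G x y).
  { intros x y; apply Rnot_lt_le; intros Hlt.
    (* [slope_gt] is strict, so it is applied with the slope itself as bound: a slope below [/ M],
       hence below every value of the derivative of [G], would be less than itself. *)
    set (l := slope G x y) in Hlt.
    enough (l < l) by lra.
    apply (slope_gt G (Rmin x y) (Rmax x y)).
    - intros z _; split; [apply exDG |].
      rewrite (is_derive_unique _ _ _ (DG z)).
      eapply Rlt_le_trans; [exact Hlt |].
      apply Rinv_le_contravar; apply HM.
    - split; [apply Rmin_l | apply Rmax_l].
    - split; [apply Rmin_r | apply Rmax_r]. }
  assert (HM' : 0 < / M) by now apply Rinv_0_lt_compat.
  assert (G0 : G x0 = 0) by apply (RInt_point x0 (fun y => / F y)).
  assert (Gc : continuity G).
  { intros x; apply continuity_pt_filterlim.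
    apply (ex_derive_continuous G), exDG. }
  assert (Hsurj : forall t, {x | G x = t}).
  { intros t.
    (* [G] vanishes at [x0] and has slopes at least [/ M], so its values at these two points enclose
       [t]. *)
    destruct (IVT_gen G (x0 - M * Rabs t) (x0 + M * Rabs t) t Gc) as (x & _ & Hx);
      [| now exists x].
    pose proof (slope_mul G x0 (x0 - M * Rabs t)) as E1.
    pose proof (slope_mul G x0 (x0 + M * Rabs t)) as E2.
    pose proof (HG x0 (x0 - M * Rabs t)) as S1.
    pose proof (HG x0 (x0 + M * Rabs t)) as S2.
    rewrite G0 in E1, E2.
    pose proof (Rabs_pos t).
    assert (/ M * (M * Rabs t) = Rabs t) by (field; lra).
    assert (0 <= M * Rabs t) by nra.
    assert (G (x0 - M * Rabs t) <= - Rabs t) by nra.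
    assert (Rabs t <= G (x0 + M * Rabs t)) by nra.
    pose proof (Rle_abs t); pose proof (Rle_abs (- t)); rewrite Rabs_Ropp in *.
    rewrite Rmin_left, Rmax_right; lra. }
  set (v t := proj1_sig (Hsurj t)).
  assert (Hv : forall t, G (v t) = t) by (intros t; apply (proj2_sig (Hsurj t))).
  (* The difference quotient of the inverse [v] is a reciprocal slope of [G]. It is at most [M], so
     [v] is Lipschitz; its continuity then gives the derivative of [v]. *)
  assert (Hvt : forall s t, v s - v t = / slope G (v t) (v s) * (s - t)).
  { intros s t; pose proof (slope_mul G (v t) (v s)) as E.
    rewrite !Hv in E; rewrite <- E.
    pose proof (HG (v t) (v s)); field; lra. }
  assert (Hinj : forall x, v (G x) = x).
  { intros x; pose proof (slope_mul G x (v (G x))) as E.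
    rewrite Hv in E; pose proof (HG x (v (G x))); nra. }
  exists v; split; [| split].
  - rewrite <- G0; apply Hinj.
  - intros t.
    assert (Cv : continuous v t).
    { apply continuity_pt_filterlim; intros eps Heps.
      exists (eps / M); split; [apply Rdiv_lt_0_compat; lra |].
      intros s [_ Hs]; unfold dist in *; simpl in *; unfold Rdist in *.
      rewrite Hvt, Rabs_mult, Rabs_pos_eq.
      + apply Rlt_div_r in Hs; [| exact HM0].
        apply Rle_lt_trans with (M * Rabs (s - t)); [| lra].
        apply Rmult_le_compat_r; [apply Rabs_pos |].
        rewrite <- (Rinv_inv M); apply Rinv_le_contravar; [exact HM' | apply HG].
      + apply Rlt_le, Rinv_0_lt_compat; pose proof (HG (v t) (v s)); lra. }
    replace (F (v t)) with (/ slope G (v t) (v t)).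
    + apply (is_derive_of_quotient v (fun s => / slope G (v t) (v s))); [| auto].
      apply continuity_pt_filterlim.
      apply (continuity_pt_inv (fun s => slope G (v t) (v s))).
      * apply continuity_pt_filterlim, (continuous_comp v (slope G (v t))); [exact Cv |].
        now apply continuous_slope.
      * pose proof (HG (v t) (v t)); lra.
    + rewrite slope_diag, (is_derive_unique _ _ _ (DG (v t))); apply Rinv_inv.
  - intros x; exists (G x); apply Hinj.
Qed.

(** * Shock states and monotonicity of a given jamiton *)

Lemma Derive_lt_of_Derive2_pos (vmin : R) (f : R -> R) :
  C2_on_I vmin f -> (forall v, vmin < v -> 0 < Derive (Derive f) v) ->
  forall x y, vmin < x -> x < y -> Derive f x < Derive f y.
Proof.
  intros Hf Hpos x y Hx Hxy.
  destruct (Derive_mvt (Derive f) x y Hxy) as (c & Hc & E).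
  - intros z Hz; apply Hf; lra.
  - pose proof (Hpos c ltac:(lra)); nra.
Qed.

Lemma Derive_lt_of_Derive2_neg (vmin : R) (f : R -> R) :
  C2_on_I vmin f -> (forall v, vmin < v -> Derive (Derive f) v < 0) ->
  forall x y, vmin < x -> x < y -> Derive f y < Derive f x.
Proof.
  intros Hf Hneg x y Hx Hxy.
  destruct (Derive_mvt (Derive f) x y Hxy) as (c & Hc & E).
  - intros z Hz; apply Hf; lra.
  - pose proof (Hneg c ltac:(lra)); nra.
Qed.

(* The shock joins two points on the same level of the strictly convex function
   [p v + m^2 v], whose minimum is at [vS]. *)
Lemma jamiton_sonic_between (vmin m vS vp vm : R) (p : R -> R) :
  C2_on_I vmin p -> (forall v, vmin < v -> 0 < Derive (Derive p) v) ->
  vmin < vS -> vmin < vp -> vp < vm -> Derive p vS = - m ^ 2 ->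
  p vm - p vp = - m ^ 2 * (vm - vp) -> vp < vS < vm.
Proof.
  intros Hp Hpos HvS Hvp Hlt HS E.
  destruct (Derive_mvt p vp vm Hlt) as (c & Hc & Ec); [intros; apply Hp; lra |].
  assert (Dc : Derive p c = Derive p vS) by (rewrite HS; apply (Rmult_eq_reg_r (vm - vp)); lra).
  pose proof (Derive_lt_of_Derive2_pos vmin p Hp Hpos) as Hmon.
  destruct (Rtotal_order c vS) as [H | [<- | H]].
  - pose proof (Hmon c vS ltac:(lra) H); lra.
  - exact Hc.
  - pose proof (Hmon vS c ltac:(lra) H); lra.
Qed.

(** A barrier argument: if [U' vS < m], the square of the positive part of [v - vS] is nonincreasing
    along the profile, yet it is 0 at [chip] and positive at [chim]. *)
Lemma jamiton_speed_le (vmin m vS chip chim : R) (U p v u dv du : R -> R) :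
  C2_on_I vmin U -> C2_on_I vmin p ->
  (forall v, vmin < v -> Derive (Derive U) v < 0) ->
  (forall v, vmin < v -> 0 < Derive (Derive p) v) ->
  vmin < vS ->
  jamiton U p vmin vS m chip chim v u dv du -> m <= Derive U vS.
Proof.
  intros HU Hp HU2 Hp2 HvS [Hm HS Hint Hv Hu Hrange Hmass Hmom RH1 RH2 Hlax].
  unfold jump in RH1, RH2.
  apply Rnot_lt_le; intros HUm.
  assert (Hvp : vmin < v chip) by (apply Hrange; lra).
  destruct (jamiton_sonic_between vmin m vS (v chip) (v chim) p) as [Hlo Hhi];
    try assumption; [nra |].
  assert (Hdiff : C1_on chip chim (fun x => u x - m * v x) (fun x => du x - m * dv x)).
  { intros x Hx; split.
    - apply Dminus; [apply Hu, Hx | apply Dmult_const, Hv, Hx].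
    - apply limit_minus; [apply Hu, Hx |].
      apply limit_mul; [| apply Hv, Hx].
      intros eps Heps; exists 1; split; [lra |].
      intros; unfold dist; simpl; now rewrite Rdist_eq. }
  assert (Hconst : forall x y, chip <= x -> x <= y -> y <= chim ->
    u y - m * v y = u x - m * v x).
  { intros x y Hx Hxy Hy.
    apply Rle_antisym.
    - apply (C1_on_comp_nonincr chip chim _ _ (fun s => s) (fun _ => 1) Hdiff);
        try assumption.
      + intros s; auto_derive; trivial.
      + intros z Hz; pose proof (Hmass z Hz); lra.
    - apply Ropp_le_cancel.
      apply (C1_on_comp_nonincr chip chim _ _ (fun s => - s) (fun _ => - 1) Hdiff);
        try assumption.
      + intros s; auto_derive; trivial.
      + intros z Hz; pose proof (Hmass z Hz); lra. }
  destruct (IVT_gen (fun x => v (clamp chip chim x)) chip chim vS) as (chi0 & H0 & E0).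
  { apply (C1_on_clamp_continuity chip chim v dv); [lra | exact Hv]. }
  { rewrite !clamp_id by lra; rewrite Rmin_left, Rmax_right; lra. }
  rewrite Rmin_left, Rmax_right in H0 by lra.
  rewrite clamp_id in E0 by exact H0.
  assert (Hu0 : forall x, chip <= x <= chim -> u x - m * v x = U vS - m * vS).
  (* At the sonic point [chi0] the left side of the momentum equation cancels, forcing
     [u chi0 = U vS]; this fixes the constant. *)
  { intros x Hx.
    pose proof (Hmom chi0 H0) as Hmom0; pose proof (Hmass chi0 H0) as Hmass0.
    rewrite E0, HS in Hmom0.
    assert (u chi0 = U vS) by nra.
    rewrite <- H, <- E0.
    destruct (Rle_dec x chi0); [symmetry |]; apply Hconst; lra. }
  (* Concavity of [U] makes its chord slope from [vS] to [v x] less than [m], while convexity of [p]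
     makes the coefficient of [dv x] positive. *)
  assert (Hdv : forall x, chip <= x <= chim -> vS < v x -> dv x < 0).
  { intros x Hx Hvx.
    pose proof (Hmom x Hx) as Hmx; pose proof (Hmass x Hx) as Hmax.
    pose proof (Hu0 x Hx) as Hux.
    destruct (Derive_mvt U vS (v x) Hvx) as (c & Hc & Ec);
      [intros; apply HU; lra |].
    pose proof (Derive_lt_of_Derive2_neg vmin U HU HU2 vS c ltac:(lra) ltac:(lra)).
    pose proof (Derive_lt_of_Derive2_pos vmin p Hp Hp2 vS (v x) ltac:(lra) ltac:(lra)).
    assert (Hmm : (Derive p (v x) + m ^ 2) * dv x = (Derive U c - m) * (v x - vS)) by nra.
    assert ((Derive U c - m) * (v x - vS) < 0) by nra.
    nra. }
  assert (Hle : Rmax 0 (v chim - vS) ^ 2 <= Rmax 0 (v chip - vS) ^ 2).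
  { apply (C1_on_comp_nonincr chip chim v dv (fun s => Rmax 0 (s - vS) ^ 2) _ Hv
      (is_derive_pos_part_sqr vS)); try lra.
    intros x Hx; unfold Rmax; destruct (Rle_dec 0 (v x - vS)) as [[H | H] | H].
    - pose proof (Hdv x Hx ltac:(lra)); nra.
    - rewrite <- H; lra.
    - lra. }
  rewrite Rmax_right, Rmax_left in Hle by lra; nra.
Qed.

(** * Construction of a jamiton *)

(** The lower of the two end values is attained again on the other side of [c]. This supplies the
    two states of the shock. *)
Lemma exists_equal_values (f : R -> R) (a c b : R) :
  a < c < b -> continuity f -> f c < f a -> f c < f b ->
  exists x y, a <= x /\ x < y /\ y <= b /\ f x = f y.
Proof.
  intros Hc Hf Ha Hb.
  destruct (Rle_lt_dec (f a) (f b)) as [H | H].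
  - destruct (IVT_gen f c b (f a) Hf) as (y & Hy & E);
      [rewrite Rmin_left, Rmax_right; lra |].
    rewrite Rmin_left, Rmax_right in Hy by lra.
    exists a, y; repeat split; lra.
  - destruct (IVT_gen f a c (f b) Hf) as (x & Hx & E);
      [rewrite Rmin_right, Rmax_left; lra |].
    rewrite Rmin_left, Rmax_right in Hx by lra.
    exists x, b; repeat split; lra.
Qed.

Lemma exists_jamiton_of_gt (vmin m vS : R) (U p : R -> R) :
  C2_on_I vmin U -> C2_on_I vmin p ->
  (forall v, vmin < v -> 0 < Derive (Derive p) v) ->
  vmin < vS -> 0 < m -> Derive p vS = - m ^ 2 -> m < Derive U vS ->
  exists_jamiton U p vmin vS.
Proof.
  intros HU Hp Hp2 HvS Hm HS HUm.
  assert (Hnear : exists d, 0 < d /\ vmin < vS - d /\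
    forall c, vS - d <= c <= vS + d -> m < Derive U c).
  { destruct (HU vS HvS) as (_ & HD & _).
    apply ex_derive_continuous in HD.
    destruct (proj2 (continuity_pt_filterlim (Derive U) vS) HD (Derive U vS - m)
      ltac:(lra)) as (d & Hd & H).
    pose proof (Rmin_l d (vS - vmin)); pose proof (Rmin_r d (vS - vmin)).
    assert (0 < Rmin d (vS - vmin)) by (apply Rmin_glb_lt; lra).
    (* Halving puts the closed interval inside the open neighbourhood and keeps its left end
       strictly above [vmin]. *)
    exists (Rmin d (vS - vmin) / 2); repeat split; try lra.
    intros c Hc.
    destruct (Req_dec vS c) as [<- | Hne]; [exact HUm |].
    specialize (H c); unfold dist in H; simpl in H; unfold Rdist in H.
    assert (Hc' : Rabs (Derive U c - Derive U vS) < Derive U vS - m).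
    { apply H; split; [split; [exact I | exact Hne] |].
      apply Rabs_lt_between; lra. }
    apply Rabs_lt_between in Hc'; lra. }
  destruct Hnear as (d & Hd & Hdv & HUd).
  set (a := vS - d); set (b := vS + d).
  (* Clamping makes both slopes positive and continuous on the whole line, as the global flow
     requires; the profile will stay in [[a, b]], where nothing is changed. *)
  set (sU x := slope U vS (clamp a b x) - m).
  set (sp x := slope (Derive p) vS (clamp a b x)).
  assert (Hcl : forall x, a <= clamp a b x <= b)
    by (intros; apply clamp_range; unfold a, b; lra).
  assert (HsU : forall x, 0 < sU x).
  { intros x; apply Rlt_0_minus.
    apply (slope_gt U a b vS m); [| unfold a, b; lra | apply Hcl].
    intros c Hc; split; [apply HU; unfold a in Hc; lra | apply HUd, Hc]. }
  assert (Hsp : forall x, 0 < sp x).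
  { intros x; apply (slope_gt (Derive p) a b vS 0); [| unfold a, b; lra | apply Hcl].
    intros c Hc; split; [apply Hp | apply Hp2]; unfold a in Hc; lra. }
  (* At [v = vS] the profile equation [(p' v + m^2) v' = U v - u] degenerates; the
     slopes divide out the common factor [v - vS]. *)
  set (F x := sU x / sp x).
  assert (HFc : continuity F).
  { apply continuity_div.
    - apply continuity_minus; [| apply continuity_const; now intros ? ?].
      apply continuous_clamp; [unfold a, b; lra |].
      intros x Hx; apply continuous_slope; apply HU; unfold a in Hx; lra.
    - apply continuous_clamp; [unfold a, b; lra |].
      intros x Hx; apply continuous_slope; apply Hp; unfold a in Hx; lra.
    - intros x; pose proof (Hsp x); lra. }
  (* [F] depends only on the clamp of its argument, so its maximum on [[a, b]] is a global bound. *)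
  destruct (continuity_ab_maj F a b) as (x1 & Hmax & _);
    [unfold a, b; lra | intros; apply HFc |].
  assert (HF : forall x, 0 < F x <= F x1).
  { intros x; split; [apply Rdiv_lt_0_compat; [apply HsU | apply Hsp] |].
    replace (F x) with (F (clamp a b x)); [apply Hmax, Hcl |].
    unfold F, sU, sp; now rewrite (clamp_id a b (clamp a b x)) by apply Hcl. }
  assert (Hmon := Derive_lt_of_Derive2_pos vmin p Hp Hp2).
  (* Equal values of [p v + m^2 v] are the momentum jump condition once [u - m v] is constant. The
     value at [vS] lies below both end values because [p' + m^2] changes sign there. *)
  destruct (exists_equal_values
    (fun x => p (clamp a b x) + m ^ 2 * clamp a b x) a vS b) as (vp & vm & Hvp & Hlt & Hvm & E).
  { unfold a, b; lra. }
  { apply (continuous_clamp (fun x => p x + m ^ 2 * x)); [unfold a, b; lra |].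
    intros x Hx; apply (ex_derive_continuous (fun x => p x + m ^ 2 * x)).
    auto_derive; apply Hp; unfold a in Hx; lra. }
  { rewrite !clamp_id by (unfold a, b; lra).
    destruct (Derive_mvt p a vS) as (c & Hc & Ec);
      [unfold a; lra | intros x Hx; apply Hp; unfold a in Hx; lra |].
    pose proof (Hmon c vS ltac:(unfold a in Hc; lra) ltac:(lra)); nra. }
  { rewrite !clamp_id by (unfold a, b; lra).
    destruct (Derive_mvt p vS b) as (c & Hc & Ec);
      [unfold b; lra | intros x Hx; apply Hp; lra |].
    pose proof (Hmon vS c ltac:(lra) ltac:(lra)); nra. }
  rewrite !clamp_id in E by lra.
  destruct (autonomous_flow F (F x1) vp) as (v & Hv0 & Dv & Hvs);
    [intros x; apply continuity_pt_filterlim, HFc | exact HF |].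
  (* [T] is the length of the smooth part: the value of [chi] at which the flow from [vp] reaches
     [vm]. *)
  destruct (Hvs vm) as [T HT].
  assert (Hinc : forall s t, s < t -> v s < v t).
  { intros s t Hst.
    destruct (Derive_mvt v s t Hst) as (c & _ & Ec); [intros; eexists; apply Dv |].
    rewrite (is_derive_unique _ _ _ (Dv c)) in Ec.
    pose proof (HF (v c)); nra. }
  assert (HT0 : 0 < T).
  { apply Rnot_le_lt; intros [H | H]; [pose proof (Hinc T 0 H) | subst T]; lra. }
  assert (Hrange : forall t, 0 <= t <= T -> a <= v t <= b).
  { intros t [Ht0 HtT]; split.
    - apply Rle_trans with vp; [exact Hvp |]; rewrite <- Hv0.
      destruct Ht0 as [H | <-]; [apply Rlt_le, Hinc, H | lra].
    - apply Rle_trans with vm; [| exact Hvm]; rewrite <- HT.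
      destruct HtT as [H | ->]; [apply Rlt_le, Hinc, H | lra]. }
  assert (Hdvc : forall t, continuous (fun t => F (v t)) t).
  { intros t; apply (continuous_comp v F).
    - apply (ex_derive_continuous v); eexists; apply Dv.
    - apply continuity_pt_filterlim, HFc. }
  (* The constant in [u] is chosen so that [u = U vS] when [v = vS]. *)
  exists m, 0, T, v, (fun t => m * v t + (U vS - m * vS)),
    (fun t => F (v t)), (fun t => m * F (v t)).
  split; unfold jump; try assumption; rewrite ?Hv0, ?HT; try lra.
  - now apply C1_on_of_derive.
  - apply C1_on_of_derive.
    + intros t; evar_last.
      * apply (is_derive_plus (fun t => m * v t) (fun _ => U vS - m * vS));
          [apply (is_derive_scal v), Dv | apply is_derive_const].
      * apply Rplus_0_r.
    + intros t; apply (continuous_scal_r m (fun t => F (v t)) t (Hdvc t)).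
  - intros t Ht; pose proof (Hrange t Ht); unfold a in *; lra.
  - intros; ring.
  - intros t Ht.
    pose proof (slope_mul U vS (v t)) as EU.
    pose proof (slope_mul (Derive p) vS (v t)) as Ep.
    pose proof (Hsp (v t)) as Hsp'.
    assert (EF : F (v t) * sp (v t) = sU (v t)) by (unfold F; field; lra).
    unfold sU, sp in *; rewrite (clamp_id a b (v t)) in * by now apply Hrange.
    rewrite HS in Ep.
    replace (Derive p (v t)) with (slope (Derive p) vS (v t) * (v t - vS) - m ^ 2) by lra.
    replace (U (v t)) with (slope U vS (v t) * (v t - vS) + U vS) by lra.
    replace (slope U vS (v t)) with (F (v t) * slope (Derive p) vS (v t) + m) by lra.
    ring.
Qed.

Theorem theorem2 :
  forall (vmin tau : R) (U p : R -> R) (vS : R),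
    0 <= vmin ->
    0 < tau ->
    C2_on_I vmin U ->
    C2_on_I vmin p ->
    (forall v, vmin < v -> 0 < Derive U v) ->
    (forall v, vmin < v -> Derive (Derive U) v < 0) ->
    (forall v, vmin < v -> Derive p v < 0) ->
    (forall v, vmin < v -> 0 < Derive (Derive p) v) ->
    vmin < vS ->
    Derive U vS <> sqrt (- Derive p vS) ->
    (exists_jamiton U p vmin vS <-> linearly_unstable U p tau vS).
Proof.
  intros vmin tau U p vS _ Htau HU Hp HU1 HU2 Hp1 Hp2 HvS Hne.
  pose proof (Hp1 vS HvS); pose proof (HU1 vS HvS).
  set (m := sqrt (- Derive p vS)) in *.
  assert (Hm : 0 < m) by (apply sqrt_lt_R0; lra).
  assert (HS : Derive p vS = - m ^ 2) by (unfold m; rewrite pow2_sqrt; lra).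
  split.
  - intros (m' & chip & chim & v & u & dv & du & J).
    assert (m' = m) as ->.
    { pose proof (jam_speed_pos _ _ _ _ _ _ _ _ _ _ _ J).
      pose proof (jam_sonic _ _ _ _ _ _ _ _ _ _ _ J); nra. }
    (* Non-degeneracy upgrades the resulting weak inequality to [m < U' vS]. *)
    apply jamiton_speed_le in J; try assumption.
    apply unstable_of_gt with m; try assumption; lra.
  - intros Hunst.
    apply (exists_jamiton_of_gt vmin m); try assumption.
    (* Otherwise non-degeneracy gives [U' vS < m], and squaring gives the stability criterion. *)
    apply Rnot_le_lt; intros Hle; apply Hunst.
    apply stable_of_lt; nra.
Qed.
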